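(* Let $v$ be an integer such that either $v = 6k+1$ for some integer $k \geq 1$, or $v = 6k+4$ for some integer $k \geq 2$. If there exists a $\mathrm{TTS}(v)$ with a Hamiltonian $2$-BIG, then there exists a $\mathrm{TTS}(2v+2)$ with a Hamiltonian $2$-BIG.
   Context: A twofold triple system of order $v$, denoted $\mathrm{TTS}(v)$, is a pair $(V,\mathcal{B})$ where $V$ is a set of $v$ points and $\mathcal{B}$ is a collection of $3$-element subsets of $V$ (called blocks or triples; repeated blocks are permitted, i.e. $\mathcal{B}$ is a multiset) such that each $2$-element subset of $V$ is contained in exactly two blocks of $\mathcal{B}$, counted with multiplicity. The $2$-block-intersection graph ($2$-BIG) of $(V,\mathcal{B})$ is the graph whose vertices are the blocks in $\mathcal{B}$ (repeated blocks giving distinct vertices), where two vertices $B_1,B_2$ are adjacent if and only if $|B_1\cap B_2|=2$. A graph is Hamiltonian if it contains a Hamilton cycle (a cycle, of length at least $3$, through all vertices). *)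

(* Defs.v *)
From mathcomp Require Import all_boot.

Set Implicit Arguments.
Unset Strict Implicit.
Unset Printing Implicit Defensive.

(* The multiset of blocks is an indexed family, so that repeated blocks have  *)
(* distinct indices.                                                          *)
Record TTS (v : nat) := MkTTS {
  tts_point : finType;
  tts_index : finType;
  tts_block : tts_index -> {set tts_point};
  tts_card_point : #|tts_point| = v;
  tts_card_block : forall i, #|tts_block i| = 3;
  tts_pair : forall P : {set tts_point},
    #|P| = 2 -> #|[set i | P \subset tts_block i]| = 2
}.

(* Irreflexive because blocks have three points; repeated blocks are not      *)
(* adjacent to each other.                                                    *)
Definition two_BIG (v : nat) (S : TTS v) : rel (tts_index S) :=
  fun i j => #|tts_block i :&: tts_block j| == 2.
Arguments two_BIG {v} S i j.

Definition Hamiltonian (T : finType) (e : rel T) : Prop :=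
  exists c : seq T, [/\ 3 <= size c, ucycle e c & forall x, x \in c].

(* Main.v *)
Require Import Defs.
From mathcomp Require Import all_boot all_algebra zify ring.

(** Every [2v+2] is of the form [6m+4] with [m >= 2], and a TTS(6m+4) with
    Hamiltonian 2-BIG can be written down directly.

    Let [g = 2m+1] and take the points [None] (infinity) and [Z_3 x Z_g].  The
    zigzag [0, 1, -1, 2, -2, ..., m, -m] runs through [Z_g] with steps of
    absolute value [1, ..., 2m], so every [{d, -d}] is a step exactly twice.
    Read its terms as differences between level [i] and level [i+1]: every step
    gives an orbit of blocks meeting the levels [i] and [i+1], consecutive steps
    give adjacent blocks, and the two ends of the zigzag are completed by the
    orbit of [{(0,s), (1,s), (2,s)}] and by blocks through infinity.  A step may
    put its pure difference on level [i] or on level [i+1]; the first two steps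
    use level [i], all the others level [i+1].  In the quotient by [Z_g] one goes
    up the zigzag of level 0, through the three orbits at infinity, down the
    zigzag of level 2, across a pure difference to the zigzag of level 1, and
    down the latter.  This Hamilton cycle of the quotient lifts to one round that
    translates by [m], a generator of [Z_g], so the rounds form a single cycle. *)

Set Implicit Arguments.
Unset Strict Implicit.
Unset Printing Implicit Defensive.

(** * Pair counting and Hamilton cycles from orbits *)

(* Double counting of the incident pairs and blocks. *)
Lemma pair_cover_exact (T I : finType) (B : I -> {set T}) :
  (forall i, #|B i| = 3) -> 2 * 'C(#|T|, 2) = 3 * #|I| ->
  (forall x y, x != y ->
     exists i j, [/\ i != j, [set x; y] \subset B i & [set x; y] \subset B j]) ->
  forall P : {set T}, #|P| = 2 -> #|[set i | P \subset B i]| = 2.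
Proof.
move=> card3 cardI cover P cardP.
have lb (Q : {set T}) : #|Q| == 2 -> 2 <= #|[set i | Q \subset B i]|.
  move=> /cards2P[x [y [xy ->]]]; have [i [j [ij Bi Bj]]] := cover x y xy.
  by apply/card_gt1P; exists i, j; rewrite !inE.
have total : \sum_(Q : {set T} | #|Q| == 2) #|[set i | Q \subset B i]| = 3 * #|I|.
  transitivity (\sum_(Q : {set T} | #|Q| == 2) \sum_(i | Q \subset B i) 1).
    by apply: eq_bigr => Q _; rewrite sum1dep_card.
  rewrite (exchange_big_dep predT) //= mulnC -sum_nat_const.
  apply: eq_bigr => i _; rewrite sum1dep_card -[RHS](_ : 'C(3, 2) = 3) //.
  by rewrite -(card3 i) -cards_draws; apply: eq_card => Q; rewrite !inE andbC.
have const : \sum_(Q : {set T} | #|Q| == 2) 2 = 3 * #|I|.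
  rewrite sum_nat_const -cardI mulnC; congr (_ * _).
  rewrite -cardsT -cards_draws; apply: eq_card => Q.
  by rewrite !inE subsetT.
have eqP2 : #|P| == 2 by apply/eqP.
(* The counts and the constant 2 have the same sum over all pairs, and each count is at least 2, so
   none exceeds 2. *)
move: total const (lb P eqP2); rewrite (bigD1 P) //= (bigD1 P eqP2) /=.
have: \sum_(Q : {set T} | (#|Q| == 2) && (Q != P)) 2 <=
      \sum_(Q : {set T} | (#|Q| == 2) && (Q != P)) #|[set i | Q \subset B i]|.
  by apply: leq_sum => Q /andP[/lb].
have arith a b c d : a <= b -> c + b = d -> 2 + a = d -> 1 < c -> c = 2 by lia.
exact: arith.
Qed.

(** The point [z] removes one of the three points of [A], and [x], [y] keep the other two. *)
Lemma card_setI_eq2 (T : finType) (A B : {set T}) (x y z : T) :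
  #|A| = 3 -> x != y -> [set x; y] \subset A -> [set x; y] \subset B ->
  z \in A -> z \notin B -> #|A :&: B| = 2.
Proof.
move=> cardA xy PA PB zA zB; apply/eqP; rewrite eqn_leq; apply/andP; split.
  have sub : A :&: B \subset A :\ z.
    apply/subsetP => t; rewrite !inE => /andP[-> tB].
    by rewrite andbT; apply: contraNneq zB => <-.
  by move: (subset_leq_card sub); rewrite (cardsD1 z A) zA in cardA *; lia.
have <- : #|[set x; y]| = 2 by rewrite cards2 xy.
by apply: subset_leq_card; rewrite subsetI PA.
Qed.

(** The orbit of [x] lists every vertex once; a preimage of [x] makes it close up into a cycle. *)
Lemma Hamiltonian_of_orbit (T : finType) (e : rel T) (f : T -> T) (x : T) :
  3 <= #|T| -> (forall y, e y (f y)) -> (forall y, fconnect f x y) ->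
  (exists y, f y = x) -> Hamiltonian e.
Proof.
move=> cardT ef reach [w fw].
have all_orbit y : y \in orbit f x by rewrite -fconnect_orbit.
exists (orbit f x); split => //.
- have /card_uniqP <- := orbit_uniq f x.
  by apply: leq_trans cardT (subset_leq_card _); apply/subsetP => y _.
- rewrite /ucycle orbit_uniq andbT.
  have : fcycle f (orbit f x).
    apply/(orbitPcycle 0 3).
    by exists (findex f x w); rewrite iterS iter_findex.
  by apply: sub_cycle => y z /eqP <-.
Qed.

(** * The zigzag through the integers modulo [2m+1] *)

Section Construction.

Variable n : nat.
Local Notation m := n.+2.
(** This is [2m+1], written with explicit successors so that the ordinals below it carry a ring
    structure. *)
Local Notation g := (n.*2.+4.+1).
Local Notation Z := 'I_(n.*2.+4.+1).
Local Open Scope ring_scope.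
Import GRing.Theory.

Lemma natr_neq0 k : (0 < k < g)%N -> k%:R != 0 :> Z.
Proof.
move=> /andP[k0 kg]; rewrite -val_eqE /= (@val_Zp_nat g) //= modn_small //.
by rewrite -lt0n.
Qed.

Lemma modulus_natr0 : g%:R = 0 :> Z.
Proof. exact: (@pchar_Zp g). Qed.

Lemma modulus_eq0 : m%:R + m%:R + 1 = 0 :> Z.
Proof. by rewrite -natrD natr1 -[RHS]modulus_natr0; congr (_%:R); lia. Qed.

Definition zigzag (j : nat) : Z :=
  if odd j then (uphalf j)%:R else - (j./2)%:R.

Lemma zigzag_even a : zigzag a.*2 = - a%:R.
Proof. by rewrite /zigzag odd_double doubleK. Qed.

Lemma zigzag_odd a : zigzag a.*2.+1 = a%:R + 1.
Proof. by rewrite /zigzag /= odd_double /= doubleK natr1. Qed.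

Lemma zigzag_step_even a : zigzag a.*2.+1 - zigzag a.*2 = a.*2.+1%:R.
Proof. rewrite zigzag_even zigzag_odd -natr1 -(addnn a) natrD; ring. Qed.

Lemma zigzag_step_odd a : zigzag a.*2.+2 - zigzag a.*2.+1 = - a.*2.+2%:R.
Proof.
rewrite -(doubleS a) zigzag_even zigzag_odd -(addnn a.+1) natrD -natr1; ring.
Qed.

Lemma zigzag_neqS j : (j.+1 < g)%N -> zigzag j.+1 != zigzag j.
Proof.
move=> jg; rewrite -subr_eq0 -[j]odd_double_half.
case: (odd j) (odd_double_half j).
  rewrite add1n => jE.
  by rewrite zigzag_step_odd oppr_eq0 natr_neq0 //; lia.
rewrite add0n => jE; rewrite zigzag_step_even natr_neq0 //; lia.
Qed.

Lemma zigzag_neqSS j : zigzag j.+2 != zigzag j.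
Proof.
rewrite -subr_eq0 -[j]odd_double_half; case: (odd j); rewrite ?add1n ?add0n.
  by rewrite -(doubleS j./2) !zigzag_odd -natr1 (_ : _ - _ = 1) //; ring.
rewrite -(doubleS j./2) !zigzag_even -natr1 (_ : _ - _ = -1) ?oppr_eq0 //; ring.
Qed.

(** Residues from 1 to [m] stand at odd positions; a residue [z > m] is [-(g - z)], at an even
    position. *)
Lemma zigzag_surj (z : Z) : exists2 k, (k < g)%N & z = zigzag k.
Proof.
have zE : z = (nat_of_ord z)%:R by rewrite natr_Zp.
have := ltn_ord z; case: (posnP (nat_of_ord z)) => [z0 _|z_gt0 z_lt].
  by exists 0%N; rewrite // zE z0 (zigzag_even 0) oppr0.
have [le_zm|lt_mz] := leqP (nat_of_ord z) m.
  exists (nat_of_ord z).-1.*2.+1; first lia.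
  by rewrite zigzag_odd natr1 prednK.
exists (g - z).*2; first lia.
rewrite zigzag_even natrB; last lia.
by rewrite -zE opprB -[LHS]subr0 -modulus_natr0.
Qed.

(** * Points, blocks, and pairs shared by consecutive blocks *)

Definition point := option ('I_3 * Z).
Definition bindex := (option ('I_3 * 'I_g) * Z)%type.

(* [(None, s)] is the transversal block; [(Some (i, j), s)] with [j < 2m] belongs
   to the step from [zigzag j] to [zigzag j.+1], and with [j = 2m] to infinity.
   The translations are normalised so that walking along a zigzag keeps [s]. *)
Definition triple (x : bindex) : seq point :=
  let s := x.2 in
  if x.1 is Some (i, j) then
    if j == 0%N :> nat then [:: Some (i, s); Some (i, s - 1); Some (i + 1, s)]
    else if j == 1%N :> nat then
      [:: Some (i, s - 1); Some (i, s + 1); Some (i + 1, s)]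
    else if j == m.*2 :> nat then
      [:: None; Some (i, s + 1); Some (i + 1, s + 1 + zigzag j)]
    else [:: Some (i, s + 1); Some (i + 1, s + 1 + zigzag j);
             Some (i + 1, s + 1 + zigzag j.+1)]
  else [:: Some (0, s); Some (1, s); Some (1 + 1, s)].

Definition block (x : bindex) : {set point} := [set p in triple x].

Lemma level_neq (i : 'I_3) : i + 1 != i.
Proof. by rewrite -subr_eq0 addrAC subrr add0r. Qed.

Lemma addr_neq (x d : Z) : d != 0 -> x + d != x.
Proof. by move=> d0; rewrite -subr_eq0 addrAC subrr add0r. Qed.

Lemma Some_eqE (i i' : 'I_3) (x x' : Z) :
  (Some (i, x) == Some (i', x') :> point) = (i == i') && (x == x').
Proof. by []. Qed.

Lemma card_block x : #|block x| = 3%N.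
Proof.
suff: uniq (triple x) /\ size (triple x) = 3%N.
  by case=> /card_uniqP U sz; rewrite cardsE U.
have one0 : 1 != 0 :> Z by [].
have two0 : 2 != 0 :> Z by apply: natr_neq0.
case: x => [[[i j]|] s] //; rewrite /triple /=.
have iN := negPf (level_neq i); have iN' : (i == i + 1) = false by rewrite eq_sym.
case: ifP => [_|j0]; last case: ifP => [_|j1]; last case: ifP => [_|j2].
all: split=> //=; rewrite !inE !Some_eqE ?eqxx ?iN ?iN' ?andbF ?andbT ?orbF //=.
- by rewrite eq_sym addr_neq ?oppr_eq0.
- by rewrite eq_sym -subr_eq0 (_ : _ - _ = 2) //; ring.
- rewrite eq_sym (inj_eq (addrI _)) zigzag_neqS //.
  by have := ltn_ord j; lia.
Qed.

(** Lower end of the link relative to [s]. During the first two steps the upper end stays at [s]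
    while the lower end moves through [s], [s - 1], [s + 1]; afterwards the lower end stays at
    [s + 1]. *)
Definition shift (k : nat) : Z := match k with 0 => 0 | 1 => -1 | _ => 1 end.

(* The pair shared by the blocks [(i, k - 1)] and [(i, k)]. *)
Definition link i k s : {set point} :=
  [set Some (i, s + shift k); Some (i + 1, s + shift k + zigzag k)].

Lemma link_up i (k : 'I_g) s : link i k s \subset block (Some (i, k), s).
Proof.
apply/subsetP => p; rewrite !inE /triple /=.
case: k => [[|[|k]] kg] /=.
- rewrite /zigzag /= addr0 oppr0 addr0.
  by move=> /orP[] /eqP ->; rewrite !inE eqxx ?orbT.
- by rewrite /zigzag /= addrNK => /orP[] /eqP ->; rewrite !inE eqxx ?orbT.
- by case: ifP => _; move=> /orP[] /eqP ->; rewrite !inE eqxx ?orbT.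
Qed.

Lemma link_down i (k : 'I_g) s (kg : (k.+1 < g)%N) :
  link i k.+1 s \subset block (Some (i, k), s).
Proof.
apply/subsetP => p; rewrite !inE /triple /=.
case: k kg => [[|[|k]] kg] /= kg'.
- by rewrite /zigzag /= addrNK => /orP[] /eqP ->; rewrite !inE eqxx ?orbT.
- by rewrite /zigzag /= addrK => /orP[] /eqP ->; rewrite !inE eqxx ?orbT.
- case: ifP => [|_]; first lia.
  by move=> /orP[] /eqP ->; rewrite !inE eqxx ?orbT.
Qed.

(** On every level the transversal block acts as the predecessor of block 0, so mixed difference 0
    is also covered twice. *)
Lemma link0 i s : link i 0 s \subset block (None, s).
Proof.
apply/subsetP => p; rewrite !inE /zigzag /= oppr0 !addr0.
by case: i => [[|[|[|//]]] ?] => /orP[] /eqP ->;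
  rewrite !Some_eqE -!val_eqE /= eqxx.
Qed.

(** * Every pair of points lies in two blocks *)

Lemma level_pair_cases (i i' : 'I_3) : [\/ i = i', i' = i + 1 | i = i' + 1].
Proof.
by case: i i' => [[|[|[|//]]] ?] [[|[|[|//]]] ?];
  [constructor 1|constructor 2|constructor 3|constructor 3|constructor 1
  |constructor 2|constructor 2|constructor 3|constructor 1]; apply: val_inj.
Qed.

Definition covered (x y : point) :=
  exists i j,
    [/\ i != j, [set x; y] \subset block i & [set x; y] \subset block j].

Lemma coveredC x y : covered x y -> covered y x.
Proof. by rewrite /covered setUC. Qed.

(** The point is the lower point of one block through infinity and the upper point of another, one
    level below. *)
Lemma covered_infty i a : covered None (Some (i, a)).
Proof.
have infty i' s :
    [set None; Some (i', s + 1)] \subset block (Some (i', ord_max), s) /\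
    [set None; Some (i' + 1, s + 1 + zigzag m.*2)]
      \subset block (Some (i', ord_max), s).
  by rewrite !subUset !sub1set !inE /triple /= !eqxx /= !inE !eqxx !orbT.
exists (Some (i, ord_max), a - 1), (Some (i - 1, ord_max), a - 1 - zigzag m.*2).
split.
- apply: contraNneq (level_neq (i - 1)) => /(congr1 fst) /= [ii].
  by rewrite subrK -ii.
- by have [] := infty i (a - 1); rewrite subrK.
- have [_] := infty (i - 1) (a - 1 - zigzag m.*2).
  by rewrite subrK (_ : a - 1 - _ + 1 + _ = a) //; ring.
Qed.

(** The difference [b - a] is some [zigzag k], so the pair is a link and lies in the two blocks that
    this link joins. *)
Lemma covered_mixed i a b : covered (Some (i, a)) (Some (i + 1, b)).
Proof.
have [k kg kE] := zigzag_surj (b - a).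
rewrite /covered.
have -> : [set Some (i, a); Some (i + 1, b)] =
    link i k (a - shift k) :> {set point}.
  by rewrite /link subrK -kE (addrC a) subrK.
case: k kg kE => [|k] kg _.
  exists (None, a - shift 0), (Some (i, Ordinal kg), a - shift 0).
  by split=> //; [exact: link0|exact: link_up (Ordinal kg) _].
exists (Some (i, Ordinal (ltnW kg)), a - shift k.+1).
exists (Some (i, Ordinal kg), a - shift k.+1); split.
- by apply/eqP => -[]; lia.
- exact: (@link_down i (Ordinal (ltnW kg))).
- exact: (@link_up i (Ordinal kg)).
Qed.

Lemma pure_pair i j s : (1 < j < m.*2)%N ->
  [set Some (i, s + 1 + zigzag j); Some (i, s + 1 + zigzag j.+1)]
    \subset block (Some (i - 1, inord j), s).
Proof.
move=> jm; rewrite subUset !sub1set !inE /triple /= inordK; last lia.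
rewrite !ifF; try lia.
by rewrite !inE subrK !eqxx !orbT.
Qed.

(** An odd difference [2c+1] is the step at the even position [2c], and also, being [-(2m-2c)]
    modulo [g], the step at an odd position. *)
Lemma covered_pure_odd i (a b : Z) :
  odd (nat_of_ord (b - a)) -> covered (Some (i, a)) (Some (i, b)).
Proof.
move=> od; pose c := (nat_of_ord (b - a))./2.
have dE : nat_of_ord (b - a) = c.*2.+1 by rewrite -[LHS]odd_double_half od.
have lt_cm : (c < m)%N by have := ltn_ord (b - a); lia.
have bE : b = a + c.*2.+1%:R by rewrite -dE natr_Zp addrC subrK.
(* Chosen so that [(2c+1) + (2c'+2) = g]. *)
pose c' := (m - c.+1)%N.
have dE' : c.*2.+1%:R = - c'.*2.+2%:R :> Z.
  apply/eqP; rewrite -subr_eq0 opprK -natrD.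
  by rewrite (_ : (_ + _)%N = g) ?modulus_natr0 //; rewrite /c'; lia.
(* The step position is recorded because it is even here and odd for [x2], which separates the two
   blocks. Positions 0 and 1 have their pure pair on their own level, the others one level up. *)
have [x1 x1E sub1] : exists2 x : bindex,
    omap (fun q => nat_of_ord q.2) x.1 = Some c.*2 &
    [set Some (i, a); Some (i, b)] \subset block x.
  case: (posnP c) => [c0|c_gt0].
    exists (Some (i, ord0), b); first by rewrite c0.
    by rewrite subUset !sub1set !inE /= bE c0 addrK !eqxx !orbT.
  exists (Some (i - 1, inord c.*2), a - 1 - zigzag c.*2).
    by rewrite /= inordK //; lia.
  have := @pure_pair i c.*2 (a - 1 - zigzag c.*2).
  rewrite (_ : _ + zigzag _ = a); last ring.
  rewrite (_ : _ + zigzag _ = b); first by apply; lia.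
  by rewrite bE -zigzag_step_even; ring.
have [x2 x2E sub2] : exists2 x : bindex,
    omap (fun q => nat_of_ord q.2) x.1 = Some c'.*2.+1 &
    [set Some (i, a); Some (i, b)] \subset block x.
  case: (posnP c') => [c0|c_gt0].
    exists (Some (i, inord 1), a - 1); first by rewrite c0 /= inordK.
    rewrite subUset !sub1set !inE /triple /= inordK //= !inE.
    rewrite bE dE' c0 /= subrK eqxx !orbT /= (_ : a - 1 - 1 = a - 2) ?eqxx //.
    by ring.
  exists (Some (i - 1, inord c'.*2.+1), a - 1 - zigzag c'.*2.+1).
    by rewrite /= inordK //; lia.
  have := @pure_pair i c'.*2.+1 (a - 1 - zigzag c'.*2.+1).
  rewrite (_ : _ + zigzag _ = a); last ring.
  rewrite (_ : _ + zigzag _ = b); first by apply; lia.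
  by rewrite bE dE' -zigzag_step_odd; ring.
exists x1, x2; split=> //; apply/eqP => x12.
by move: x1E; rewrite x12 x2E => -[]; lia.
Qed.

Lemma odd_opp (z : Z) :
  z != 0 -> ~~ odd (nat_of_ord z) -> odd (nat_of_ord (- z)).
Proof.
rewrite -val_eqE -lt0n /=; move: (nat_of_ord z) (ltn_ord z) => k kg k0 ev.
by rewrite modn_small; lia.
Qed.

Lemma covered_neq x y : x != y -> covered x y.
Proof.
case: x y => [[i a]|] [[i' b]|] // xy; last exact: covered_infty.
- case: (level_pair_cases i i') => ii'; rewrite {}ii' in xy *.
  + have ab : a != b by apply: contraNneq xy => ->.
    (* As [g] is odd, one of [b - a] and [a - b] has an odd representative. *)
    case: (boolP (odd (nat_of_ord (b - a)))) => [|ev].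
      exact: covered_pure_odd.
    apply: coveredC; apply: covered_pure_odd; rewrite -opprB odd_opp //.
    by rewrite subr_eq0 eq_sym.
  + exact: covered_mixed.
  + exact/coveredC/covered_mixed.
- exact/coveredC/covered_infty.
Qed.

Lemma card_point : #|{: point}| = (6 * m + 4)%N.
Proof. by rewrite card_option card_prod !card_ord; lia. Qed.

Lemma block_pair (P : {set point}) :
  #|P| = 2%N -> #|[set x | P \subset block x]| = 2%N.
Proof.
apply: pair_cover_exact P; [exact: card_block| |exact: covered_neq].
rewrite card_point card_prod card_option card_prod !card_ord bin2.
lia.
Qed.

Definition construction : TTS (6 * m + 4) :=
  MkTTS card_point card_block block_pair.

(** * The successor map and adjacency along it *)

Definition bnext (x : bindex) : bindex :=
  let s := x.2 in
  if x.1 is Some (i, j) then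
    if i == 0 then
      if j == ord_max then (Some (1, ord_max), s - m%:R)
      else (Some (0, inord j.+1), s)
    else if (i == 1) && (j == ord_max) then (Some (1 + 1, ord_max), s - m%:R)
    else if j == ord0 then
      if i == 1 then (None, s) else (Some (1, inord m.*2.-1), s - 1 + m%:R)
    else (Some (i, inord j.-1), s)
  else (Some (0, ord0), s).

Definition adj x y := #|block x :&: block y| == 2.

Lemma adjC x y : adj x y = adj y x.
Proof. by rewrite /adj setIC. Qed.

Lemma adj_transversal i s : adj (None, s) (Some (i, ord0), s).
Proof.
rewrite adjC; apply/eqP.
apply: (@card_setI_eq2 _ _ _ (Some (i, s + shift 0))
  (Some (i + 1, s + shift 0 + zigzag 0)) (Some (i, s - 1))) => //.
- exact: card_block.
- by rewrite Some_eqE eq_sym (negPf (level_neq i)).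
- exact: (link_up i ord0).
- exact: link0.
- by rewrite !inE eqxx orbT.
- by rewrite !inE /= !Some_eqE (negPf (addr_neq s _)) ?andbF // oppr_eq0.
Qed.

Lemma adj_path i k s : (k < m.*2)%N ->
  adj (Some (i, inord k), s) (Some (i, inord k.+1), s).
Proof.
move=> km; apply/eqP.
(* The third point of block [k], outside the link [k.+1]. *)
have [z zin znot] : exists2 z, z \in block (Some (i, inord k), s) &
    z \notin block (Some (i, inord k.+1), s).
  have iN := negPf (level_neq i).
  have iN' : (i == i + 1) = false by rewrite eq_sym.
  case: k km => [|[|k]] km.
  - exists (Some (i, s)); rewrite !inE /triple /= !inordK // !inE ?eqxx //=.
    rewrite !Some_eqE iN' eqxx /= orbF.
    rewrite eq_sym -subr_eq0 (_ : s - 1 - s = - 1); last ring.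
    rewrite oppr_eq0 /= eq_sym addr_neq //.
  - exists (Some (i, s - 1)); rewrite !inE /triple /= !inordK // !inE ?eqxx //=.
    rewrite !Some_eqE iN' eqxx /= orbF.
    rewrite eq_sym -subr_eq0 (_ : _ - _ = 2); last ring.
    exact: natr_neq0.
  - exists (Some (i + 1, s + 1 + zigzag k.+2)).
      rewrite !inE /triple /= inordK; last lia.
      by rewrite ifF ?inE ?eqxx ?orbT //; lia.
    rewrite !inE /triple /= inordK; last lia.
    case: ifP => _; rewrite !inE !Some_eqE iN eqxx /= ?(inj_eq (addrI _)).
      by rewrite eq_sym zigzag_neqS.
    by rewrite negb_or ![zigzag k.+2 == _]eq_sym zigzag_neqS ?zigzag_neqSS.
apply: (@card_setI_eq2 _ _ _ (Some (i, s + shift k.+1))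
  (Some (i + 1, s + shift k.+1 + zigzag k.+1)) z) => //.
- exact: card_block.
- by rewrite Some_eqE eq_sym (negPf (level_neq i)).
- have := @link_down i (inord k) s; rewrite inordK; last lia.
  by apply; lia.
- have := @link_up i (inord k.+1) s; rewrite inordK //; lia.
Qed.

(** Besides infinity, the upper point of the first block is the lower point of the second, because
    [zigzag m.*2] is [-m]; this forces the translation by [-m]. *)
Lemma adj_infty i s :
  adj (Some (i, ord_max), s) (Some (i + 1, ord_max), s - m%:R).
Proof.
apply/eqP; apply: (@card_setI_eq2 _ _ _ None (Some (i + 1, s + 1 + zigzag m.*2))
  (Some (i, s + 1))) => //.
- exact: card_block.
- by rewrite subUset !sub1set !inE /triple /= eqxx !inE !eqxx !orbT.
- rewrite subUset !sub1set !inE /triple /= eqxx !inE zigzag_even.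
  by rewrite (_ : s + 1 - m%:R = s - m%:R + 1) ?eqxx ?orbT //; ring.
- by rewrite !inE /triple /= eqxx !inE eqxx orbT.
- rewrite !inE /triple /= eqxx !inE !Some_eqE.
  by rewrite -addrA; case: i => [[|[|[|//]]] ?].
Qed.

(** The step from [m] to [-m] is [-2m = 1], so its pure pair on level 2 can be matched with the pair
    [s], [s - 1] of block 0 there. *)
Lemma adj_turn s :
  adj (Some (1 + 1, ord0), s) (Some (1, inord m.*2.-1), s - 1 + m%:R).
Proof.
have zE : zigzag m.*2.-1 = m%:R.
  by rewrite (_ : m.*2.-1 = n.+1.*2.+1) // zigzag_odd natr1.
apply/eqP; apply: (@card_setI_eq2 _ _ _ (Some (1 + 1, s)) (Some (1 + 1, s - 1))
  (Some (1 + 1 + 1, s))) => //.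
- exact: card_block.
- by rewrite Some_eqE eq_sym (negPf (addr_neq s _)) ?andbF // oppr_eq0.
- by rewrite subUset !sub1set !inE !eqxx !orbT.
- rewrite subUset !sub1set !inE /triple /= inordK; last lia.
  rewrite !ifF; try lia.
  rewrite !inE zE -[zigzag _.+1]/(zigzag m.*2) zigzag_even.
  rewrite (_ : s - 1 + m%:R + 1 - m%:R = s); last ring.
  rewrite (_ : s - 1 + m%:R + 1 + m%:R = s - 1);
    last by rewrite -[RHS]addr0 -modulus_eq0; ring.
  by rewrite !eqxx !orbT.
- by rewrite !inE eqxx !orbT.
- rewrite !inE /triple /= inordK; last lia.
  rewrite !ifF; try lia.
  by rewrite !inE !Some_eqE.
Qed.

Lemma level_cases (i : 'I_3) : [\/ i = 0, i = 1 | i = 1 + 1].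
Proof.
by case: i => [[|[|[|//]]] ?];
  [constructor 1|constructor 2|constructor 3]; apply: val_inj.
Qed.

Lemma ord_maxE (j : 'I_g) : (j == ord_max) = (j == m.*2 :> nat).
Proof. by rewrite -val_eqE. Qed.

Lemma adj_bnext x : adj x (bnext x).
Proof.
case: x => [[[i j]|] s]; last exact: adj_transversal.
have jg := ltn_ord j.
have down i' : j != ord0 -> adj (Some (i', j), s) (Some (i', inord j.-1), s).
  rewrite -val_eqE /= => j0; rewrite adjC.
  have := @adj_path i' j.-1 s; rewrite prednK ?inord_val; last lia.
  by apply; lia.
case: (level_cases i) => ->; rewrite /bnext /=.
- case: eqP => [->|/eqP]; first by have := adj_infty 0 s; rewrite add0r.
  rewrite ord_maxE => jm.
  by have := @adj_path 0 j s; rewrite inord_val; apply; lia.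
- case: eqP => [->|_]; first exact: adj_infty.
  case: eqP => [->|/eqP]; first by rewrite adjC adj_transversal.
  exact: down.
- case: eqP => [->|/eqP]; first exact: adj_turn.
  exact: down.
Qed.

(** * The orbit of the successor map is everything *)

Lemma inord0 : inord 0 = ord0 :> 'I_g.
Proof. by apply: val_inj; rewrite /= inordK. Qed.

Lemma inord_max : inord m.*2 = ord_max :> 'I_g.
Proof. by apply: val_inj; rewrite /= inordK. Qed.

Lemma reach_up k s : (k < g)%N -> fconnect bnext (None, s) (Some (0, inord k), s).
Proof.
elim: k => [|k IHk] kg.
  by rewrite inord0; exact: fconnect1.
apply: connect_trans (IHk (ltnW kg)) _.
have : bnext (Some (0, inord k), s) = (Some (0, inord k.+1), s).
  by rewrite /bnext /= ord_maxE inordK ?ifF //; lia.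
by move=> <-; exact: fconnect1.
Qed.

(** On level 1 the descent starts below [m.*2]: the top block there is visited on the passage
    through infinity instead. *)
Lemma reach_down i k l s : i != 0 -> (k <= l < g)%N ->
  (i == 1) ==> (l < m.*2)%N ->
  fconnect bnext (Some (i, inord l), s) (Some (i, inord k), s).
Proof.
move=> i0 /andP[/subnK <-] lg; elim: (l - k)%N lg => [|d IHd] lg l1.
  exact: connect0.
rewrite addSn; apply: connect_trans (IHd _ _).
have : bnext (Some (i, inord (d + k).+1), s) = (Some (i, inord (d + k)), s).
  rewrite /bnext /= (negPf i0) ord_maxE inordK //.
  rewrite ifF; last by move: l1; case: (i == 1) => //=; lia.
  by rewrite -val_eqE /= inordK.
- by move=> <-; exact: fconnect1.
- lia.
- by move: l1; case: (i == 1) => //=; lia.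
Qed.

Lemma reach_top2 s :
  fconnect bnext (Some (0, ord_max), s) (Some (1 + 1, ord_max), s + 1).
Proof.
apply: connect_trans (fconnect1 _ _) _; rewrite /bnext /= eqxx.
apply: connect_trans (fconnect1 _ _) _; rewrite /bnext /= eqxx.
rewrite (_ : s - m%:R - m%:R = s + 1); first exact: connect0.
by rewrite -[RHS]subr0 -modulus_eq0; ring.
Qed.

Lemma reach_level2 k s : (k < g)%N ->
  fconnect bnext (None, s) (Some (1 + 1, inord k), s + 1).
Proof.
move=> kg; apply: connect_trans (@reach_up m.*2 s _) _ => //.
rewrite inord_max; apply: connect_trans (reach_top2 s) _.
by rewrite -inord_max; apply: reach_down => //; lia.
Qed.

Lemma reach_level1 k s : (k < m.*2)%N ->
  fconnect bnext (None, s) (Some (1, inord k), s + m%:R).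
Proof.
move=> km; apply: connect_trans (@reach_level2 0 s _) _ => //.
rewrite inord0; apply: connect_trans (fconnect1 _ _) _; rewrite /bnext /= addrK.
by apply: reach_down => //; lia.
Qed.

(** The translations of a round are [-m] twice at infinity and [m - 1] at the turn: in total
    [-m - 1 = m]. *)
Lemma reach_round s : fconnect bnext (None, s) (None, s + m%:R).
Proof.
apply: connect_trans (@reach_level1 0 s _) _ => //.
by rewrite inord0; exact: fconnect1.
Qed.

Lemma reach_transversal s t : fconnect bnext (None, s) (None, t).
Proof.
have rounds k : fconnect bnext (None, s) (None, s + k%:R * m%:R).
  elim: k => [|k IHk]; first by rewrite mul0r addr0 connect0.
  apply: connect_trans IHk _.
  rewrite (_ : s + k.+1%:R * _ = s + k%:R * m%:R + m%:R); last ring.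
  exact: reach_round.
(* The inverse of [m] modulo [2m+1] is [-2], which gives the number of rounds. *)
have := rounds (nat_of_ord (- (2 * (t - s)))); rewrite natr_Zp.
rewrite (_ : _ + _ = t) //.
by rewrite -[RHS]subr0 -(mulr0 (t - s)) -modulus_eq0; ring.
Qed.

Lemma reach_all s x : fconnect bnext (None, s) x.
Proof.
case: x => [[[i j]|] t]; last exact: reach_transversal.
rewrite -(inord_val j); have jg := ltn_ord j.
case: (level_cases i) => ->.
- exact: connect_trans (reach_transversal s t) (reach_up _ _).
- have [jm|jm] := ltnP j m.*2.
    apply: connect_trans (reach_transversal s (t - m%:R)) _.
    by have := reach_level1 (t - m%:R) jm; rewrite subrK.
  have -> : j = ord_max by apply: val_inj => /=; lia.
  apply: connect_trans (reach_transversal s (t + m%:R)) _.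
  apply: connect_trans (@reach_up m.*2 _ _) _ => //.
  rewrite inord_max.
  apply: connect_trans (fconnect1 _ _) _; rewrite /bnext /= eqxx addrK.
  exact: connect0.
- apply: connect_trans (reach_transversal s (t - 1)) _.
  by have := reach_level2 (t - 1) jg; rewrite subrK.
Qed.

Lemma construction_Hamiltonian : Hamiltonian (two_BIG construction).
Proof.
apply: (@Hamiltonian_of_orbit _ _ bnext (None, 0)).
- rewrite card_prod card_option card_prod !card_ord; lia.
- exact: adj_bnext.
- exact: reach_all.
(* The bottom of level 1 ends a round and leads back to the transversal block. *)
- by exists (Some (1, ord0), 0).
Qed.

End Construction.

Theorem theorem5p1 (v : nat)
  (hv : (exists k : nat, 1 <= k /\ v = 6 * k + 1) \/
        (exists k : nat, 2 <= k /\ v = 6 * k + 4)) :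
  (exists S : TTS v, Hamiltonian (two_BIG S)) ->
  exists S : TTS (2 * v + 2), Hamiltonian (two_BIG S).
Proof.
move=> _; have [n ->] : exists n, 2 * v + 2 = 6 * n.+2 + 4.
  (* Here [m] is [2k] or [2k+1], and [n] is [m - 2]. *)
  by case: hv => -[k [k_ge ->]]; [exists (2 * k).-2|exists (2 * k).-1]; lia.
by exists (construction n); exact: construction_Hamiltonian.
Qed.
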